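(* Let $\mathcal{H}$ be a Hilbert space of finite dimension $d$ with fixed computational basis $\{|j\rangle\}_{j=1}^d$, and let $|f_1\rangle=\frac{1}{\sqrt d}\sum_{j=1}^d|j\rangle$. For any density matrix $\rho$ on $\mathcal{H}$, $$\mathcal{T}_{\mathrm{F}}(\rho)\leqslant\mathcal{T}_{\mathrm{SR}}(\rho).$$
   Context: A density matrix is a positive semidefinite operator of trace one. The fidelity-based texture measure is $\mathcal{T}_{\mathrm{F}}(\rho)=1-\langle f_1|\rho|f_1\rangle$. The state rugosity is $\mathcal{T}_{\mathrm{SR}}(\rho)=-\ln(\langle f_1|\rho|f_1\rangle)$, taken to be $+\infty$ when $\langle f_1|\rho|f_1\rangle=0$. *)

(* Defs.v *)
From mathcomp Require Import all_boot all_order all_algebra.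
From mathcomp Require Import sesquilinear spectral complex.
From mathcomp Require Import all_classical all_reals all_analysis.

Set Implicit Arguments.
Unset Strict Implicit.
Unset Printing Implicit Defensive.

Import Order.TTheory GRing.Theory Num.Theory.

Local Open Scope ring_scope.
Local Open Scope complex_scope.
Local Open Scope sesquilinear_scope.

(* The Hilbert space of dimension d with its computational basis is C^d, as
   column vectors over R[i], with the standard basis |j> = delta_mx j 0;
   operators are matrices, and the bra <v| is v^t*. *)

Definition braket {R : realType} {d : nat} (u : 'cV[R[i]]_d)
    (A : 'M[R[i]]_d) (v : 'cV[R[i]]_d) : R[i] :=
  (u^t* *m A *m v) 0 0.

(* In R[i], 0 <= z means that z is real and nonnegative. *)
Definition psdmx {R : realType} {d : nat} (A : 'M[R[i]]_d) : Prop :=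
  A \is hermsymmx /\ forall v : 'cV[R[i]]_d, 0 <= braket v A v.

(* The trace condition excludes d = 0. *)
Definition density_matrix {R : realType} {d : nat} (rho : 'M[R[i]]_d) : Prop :=
  psdmx rho /\ \tr rho = 1.

Definition ketf1 {R : realType} (d : nat) : 'cV[R[i]]_d :=
  ((Num.sqrt (d%:R : R))^-1)%:C *: \sum_(j < d) delta_mx j 0.

(* For Hermitian rho the number <f_1|rho|f_1> is real, so taking the real part
   only changes its type from R[i] to R. *)
Definition f1_overlap {R : realType} {d : nat} (rho : 'M[R[i]]_d) : R :=
  complex.Re (braket (ketf1 d) rho (ketf1 d)).

Definition texture_fidelity {R : realType} {d : nat} (rho : 'M[R[i]]_d) : R :=
  1 - f1_overlap rho.

(* lne 0 = -oo, so the rugosity is +oo when the overlap vanishes. *)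
Definition state_rugosity {R : realType} {d : nat} (rho : 'M[R[i]]_d) : \bar R :=
  (- lne (f1_overlap rho)%:E)%E.

(* Main.v *)
Require Import Defs.
From mathcomp Require Import all_boot all_order all_algebra.
From mathcomp Require Import complex.
From mathcomp Require Import all_classical all_reals all_analysis.

Import Order.TTheory GRing.Theory Num.Theory.

Local Open Scope ring_scope.

(** With [p] the overlap, the claim is [1 - p <= - ln p]: the graph of [ln] lies below its tangent
    [p - 1] at [1] ([le_ln1Dx]). Positivity of [rho] gives [0 <= p], and [p = 0] is treated
    apart. *)

Lemma f1_overlap_ge0 (R : realType) (d : nat) (rho : 'M[R[i]]_d) :
  psdmx rho -> 0 <= f1_overlap rho.
Proof.
move=> [_ /(_ (ketf1 d))]; rewrite /f1_overlap.
(* The order on [R[i]] is a conjunction: equal imaginary parts and ordered real parts. *)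
by case: (braket _ _ _) => a b /andP[].
Qed.

Theorem proposition4 (R : realType) (d : nat) (rho : 'M[R[i]]_d)
    (hrho : density_matrix rho) :
  ((texture_fidelity rho)%:E <= state_rugosity rho)%E.
Proof.
have := @f1_overlap_ge0 R d rho hrho.1.
rewrite /texture_fidelity /state_rugosity le_eqVlt => /predU1P[<- | p_gt0].
  (* Zero overlap: the right-hand side is [+oo]. *)
  by rewrite le0_lneNy ?leey.
rewrite lne_EFin // -EFinN lee_fin lerNr opprB.
(* The side condition [-1 < p - 1] amounts to [p_gt0]. *)
by have := @le_ln1Dx R (f1_overlap rho - 1); rewrite subrKC ltrBrDl subrr; apply.
Qed.
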